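(* Let $B\subset[a,b]$ be symmetrically porous and let $h:[a,b]\to\mathbb{R}$ be continuously differentiable and bilipschitz. Then $h(B)$ is symmetrically porous.
   Context: Bilipschitz means there is $L>0$ with $L^{-1}|x-y|\le|h(x)-h(y)|\le L|x-y|$ for all $x,y\in[a,b]$. Symmetric porosity: for $M\subset\mathbb{R}$, $x\in M$, $R>0$, let $S\gamma(x,R,M)$ be the supremum of all $r>0$ for which there exists $z\in\mathbb{R}$ with $B(z,r)\cup B(2x-z,r)\subset B(x,R)\setminus M$, where $B(z,r)=(z-r,z+r)$ (the supremum is $0$ if there is no such $r$). The symmetric upper porosity of $M$ at $x$ is $S\overline{p}(M,x)=2\limsup_{R\to0+}S\gamma(x,R,M)/R$. The set $M$ is symmetrically porous if $S\overline{p}(M,x)>0$ for all $x\in M$. *)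

(* Defs.v *)
From HB Require Import structures.
From mathcomp Require Import all_boot all_order all_algebra.
From mathcomp Require Import all_classical all_reals all_analysis.

Set Implicit Arguments.
Unset Strict Implicit.
Unset Printing Implicit Defensive.

Import Order.TTheory GRing.Theory Num.Theory.
Import numFieldNormedType.Exports.

Local Open Scope classical_set_scope.
Local Open Scope ring_scope.

(* For R0 > 0 the set is bounded above by R0, and [sup set0 = 0]. *)
Definition Sgamma (R : realType) (x R0 : R) (M : set R) : R :=
  sup [set r | 0 < r /\
    exists z : R, ball z r `|` ball (2 * x - z) r `<=` ball x R0 `\` M].

Definition sym_upper_porosity (R : realType) (M : set R) (x : R) : \bar R :=
  (2%:E * limf_esup (fun R0 : R => (Sgamma x R0 M / R0)%:E) 0^'+)%E.

Definition sym_porous (R : realType) (M : set R) : Prop :=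
  forall x, M x -> (0 < sym_upper_porosity M x)%E.

(* Functions on A are represented by total functions whose values outside A
   play no role: difference quotients are only taken inside A, so the
   derivative at an endpoint of an interval A is one-sided. *)
Definition has_derivative_within (R : realType) (A : set R) (h : R -> R)
    (x l : R) : Prop :=
  (fun y => (h y - h x) / (y - x)) @ within A x^' --> l.

Definition cont_differentiable_on (R : realType) (A : set R) (h : R -> R)
    : Prop :=
  exists h' : R -> R,
    (forall x, A x -> has_derivative_within A h x (h' x)) /\
    {within A, continuous h'}.

Definition bilipschitz_on (R : realType) (A : set R) (h : R -> R) : Prop :=
  exists L : R, 0 < L /\
    forall x y, A x -> A y ->
      L^-1 * `|x - y| <= `|h x - h y| <= L * `|x - y|.

(* Main.v *)
(** Near a point [x] of [B], [h] agrees with its affine approximation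
    [t |-> h x + w * (t - x)], [w != 0], up to [e * `|t - x|].  The affine map
    sends a pair of holes symmetric about [x] to a pair symmetric about [h x];
    since the holes have radius at least a fixed multiple of their distance to
    [x], halving the radii absorbs the error once [e] is small. *)
Require Import Defs.
From HB Require Import structures.
From mathcomp Require Import all_boot all_order all_algebra.
From mathcomp Require Import all_classical all_reals all_analysis.
From mathcomp Require Import ring lra.

Import Order.TTheory GRing.Theory Num.Theory.
Import numFieldNormedType.Exports.

Local Open Scope classical_set_scope.
Local Open Scope ring_scope.

Lemma ball_norm_iff (R : realType) (x r y : R) : ball x r y <-> `|y - x| < r.
Proof. by rewrite -ball_normE /ball_ /= distrC. Qed.

Lemma radius_le_of_ball_sub (R : realType) (x z r R0 : R) :
  0 < R0 -> ball z r `<=` ball x R0 -> r <= R0.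
Proof.
move=> R0_gt0 sub; rewrite leNgt; apply/negP => R0r.
have /sub/ball_norm_iff : ball z r (z + R0).
  by apply/ball_norm_iff; rewrite addrC addKr gtr0_norm.
have /sub/ball_norm_iff : ball z r (z - R0).
  by apply/ball_norm_iff; rewrite addrC addKr normrN gtr0_norm.
by rewrite !ltr_norml => /andP[? ?] /andP[? ?]; lra.
Qed.

Lemma sym_upper_porosity_gt0P (R : realType) (M : set R) (x : R) :
  (0 < sym_upper_porosity M x)%E <->
  exists2 c : R, 0 < c & forall d, 0 < d -> exists R0 r z : R,
    [/\ 0 < R0, R0 < d, c * R0 < r &
        ball z r `|` ball (2 * x - z) r `<=` ball x R0 `\` M].
Proof.
rewrite /sym_upper_porosity pmule_rgt0 ?lte_fin //; split.
- move=> lim_gt0.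
  have [c c_gt0 c_lt] : exists2 c : R, 0 < c &
      (c%:E < limf_esup (fun R0 => (Sgamma x R0 M / R0)%:E) 0^'+)%E.
    case: limf_esup lim_gt0 => [l| |] //.
      by rewrite lte_fin => l_gt0; exists (l / 2); rewrite ?lte_fin; lra.
    by exists 1 => //; rewrite ltry.
  exists c => // d d_gt0.
  have near_d : (0 : R)^'+ [set R0 | 0 < R0 < d].
    near=> R0; apply/andP; split; near: R0.
    - exact: nbhs_right_gt.
    - exact: nbhs_right_lt.
  have /ereal_sup_gt[_ [R0 /= /andP[R0_gt0 R0d] <-]] : (c%:E < ereal_sup
      [set (Sgamma x R0 M / R0)%:E | R0 in [set R0 | (0 < R0 < d)%R]])%E.
    by apply: lt_le_trans c_lt (ereal_inf_lbound _); exists [set R0 | 0 < R0 < d].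
  rewrite lte_fin ltr_pdivlMr // => cR0.
  have /sup_gt/(_ cR0)[r [r_gt0 [z sub]] cr] :
      [set r | 0 < r /\ exists z : R,
        ball z r `|` ball (2 * x - z) r `<=` ball x R0 `\` M] !=set0.
    apply/set0P/eqP => S0; move: cR0; rewrite /Sgamma S0 sup0.
    by apply/negP; rewrite -leNgt mulr_ge0 ?ltW.
  by exists R0, r, z.
- move=> [c c_gt0 holes].
  apply: (@lt_le_trans _ _ c%:E); first by rewrite lte_fin.
  apply/ereal_infP => _ [V V0 <-].
  have [d /= d_gt0 dV] : nbhs (0 : R) [set y | 0 < y -> V y] by [].
  have [R0 [r [z [R0_gt0 R0d cr sub]]]] := holes _ d_gt0.
  apply: le_ereal_sup_tmp; exists (Sgamma x R0 M / R0)%:E.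
    exists R0 => //; apply: dV => //=.
    by rewrite sub0r normrN gtr0_norm.
  rewrite lee_fin ler_pdivlMr //; apply/ltW/(lt_le_trans cr).
  apply: ub_le_sup; last first.
    split; last by exists z.
    by apply: lt_trans cr; rewrite mulr_gt0.
  exists R0 => s [_ [u subu]]; apply: (radius_le_of_ball_sub _ x u) => //.
  by move=> y uy; have [] := subu y (or_introl uy).
Unshelve. all: by end_near. Qed.

Lemma has_derivative_within_approx {R : realType} {A : set R} {h : R -> R}
    {x l : R} : has_derivative_within A h x l ->
  forall e, 0 < e -> exists2 d, 0 < d & forall t, A t -> `|t - x| < d ->
    `|h t - h x - l * (t - x)| <= e * `|t - x|.
Proof.
move=> /cvgrPdist_lt dh e e_gt0.
have [d /= d_gt0 dP] : nbhs x
    [set t | t != x -> A t -> `|l - (h t - h x) / (t - x)| < e].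
  exact: dh e_gt0.
exists d => // t At tx.
have [->|t_neq_x] := eqVneq t x; first by rewrite !subrr mulr0 subrr normr0 mulr0.
have tx0 : t - x != 0 by rewrite subr_eq0.
have est : `|(h t - h x) / (t - x) - l| <= e.
  by rewrite distrC; apply/ltW/dP => //=; rewrite distrC.
rewrite -[h t - h x](divfK tx0) -mulrBl normrM.
by rewrite ler_wpM2r.
Qed.

(* At an isolated point of [A] every number is a derivative within [A], zero
   included; this is why [l] itself may have to be replaced. *)
Lemma bilipschitz_derivative_neq0 {R : realType} {A : set R} {h : R -> R}
    {x l : R} : bilipschitz_on A h -> A x -> has_derivative_within A h x l ->
  exists2 w, w != 0 & has_derivative_within A h x w.
Proof.
move=> [L [L_gt0 hL]] Ax dh.
have [l0|] := eqVneq l 0; last by exists l.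
have Li_gt0 : 0 < L^-1 by rewrite invr_gt0.
have [|d d_gt0 dP] := has_derivative_within_approx dh (L^-1 / 2).
  by rewrite divr_gt0.
have iso t : A t -> `|t - x| < d -> t = x.
  move=> At tx; have := dP t At tx; rewrite l0 mul0r subr0 => up.
  have /andP[lo _] := hL t x At Ax.
  apply/eqP; rewrite -subr_eq0 -normr_le0 leNgt; apply/negP => tx_gt0.
  have : 0 < L^-1 * `|t - x| by rewrite mulr_gt0.
  by move: lo up; rewrite mulrAC; lra.
exists 1; rewrite ?oner_neq0 // => V _.
change (nbhs x [set t | t != x -> A t -> V ((h t - h x) / (t - x))]).
exists d => //= t; rewrite /= distrC => tx /eqP t_neq_x At.
by case: t_neq_x; apply: iso.
Qed.

Theorem lemma4p6 (R : realType) (a b : R) (B : set R) (h : R -> R) :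
  B `<=` `[a, b] ->
  sym_porous B ->
  cont_differentiable_on `[a, b] h ->
  bilipschitz_on `[a, b] h ->
  sym_porous (h @` B).
Proof.
move=> sBA porB [h' [dh _]] biL _ [x Bx <-].
have Ax := sBA x Bx.
have [w w_neq0 dw] := bilipschitz_derivative_neq0 biL Ax (dh x Ax).
have [L [L_gt0 hL]] := biL.
have aw_gt0 : 0 < `|w| by rewrite normr_gt0.
have /sym_upper_porosity_gt0P[c c_gt0 holes] := porB x Bx.
apply/sym_upper_porosity_gt0P; exists (c / 2); first by rewrite divr_gt0.
move=> d d_gt0.
have [|d1 d1_gt0 approx] := has_derivative_within_approx dw (c / (2 * L)).
  by rewrite divr_gt0 // mulr_gt0.
have [|R0 [r [z [R0_gt0 R0d cr sub]]]] :=
    holes (Num.min (d / `|w|) (d1 / (L * `|w|))).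
  by rewrite lt_min !divr_gt0 // mulr_gt0.
move: R0d; rewrite lt_min !ltr_pdivlMr ?mulr_gt0 // => /andP[R0d R0d1].
exists (`|w| * R0), (`|w| * (r / 2)), (h x + w * (z - x)).
split; [by rewrite mulr_gt0|by rewrite mulrC| |].
  by rewrite mulrCA ltr_pM2l //; lra.
(* One statement for both balls: [s] is [z] or its reflection [2 * x - z]. *)
have image_hole s : ball s r `<=` ball x R0 `\` B ->
    ball (h x + w * (s - x)) (`|w| * (r / 2))
      `<=` ball (h x) (`|w| * R0) `\` (h @` B).
  move=> subs u /ball_norm_iff us.
  have r_gt0 : 0 < r by apply: lt_trans cr; rewrite mulr_gt0.
  have uR : `|u - h x| < `|w| * R0.
    have uE : u - h x = w * ((u - h x) / w) by rewrite mulrC divfK.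
    move: us; rewrite opprD addrA uE -mulrBr !normrM !ltr_pM2l // => us.
    have /subs[/ball_norm_iff] : ball s r (x + (u - h x) / w).
      apply/ball_norm_iff.
      rewrite (_ : x + _ - s = (u - h x) / w - (s - x)); last by lra.
      by lra.
    by rewrite addrC addKr normrM.
  split; first exact/ball_norm_iff.
  move=> [t Bt htu].
  have At := sBA t Bt.
  have tx : `|t - x| < L * (`|w| * R0).
    have /andP[lo _] := hL t x At Ax.
    rewrite -ltr_pdivrMl //; apply: le_lt_trans lo _.
    by rewrite htu.
  have /(approx t At) err : `|t - x| < d1.
    by apply: lt_trans tx _; rewrite mulrA mulrC.
  have err_lt : `|h t - h x - w * (t - x)| < `|w| * (r / 2).
    apply: le_lt_trans err _.
    apply: (@lt_trans _ _ (c / (2 * L) * (L * (`|w| * R0)))).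
      by rewrite ltr_pM2l // divr_gt0 // mulr_gt0.
    rewrite (_ : c / (2 * L) * _ = `|w| * (c * R0 / 2)).
      by rewrite ltr_pM2l //; lra.
    by field; rewrite gt_eqF.
  have /subs[_ /(_ Bt)//] : ball s r t.
  apply/ball_norm_iff; rewrite -(ltr_pM2l aw_gt0) -normrM.
  rewrite (_ : w * (t - s) = (u - (h x + w * (s - x)))
    - (h t - h x - w * (t - x))); last by rewrite htu; lra.
  by apply: le_lt_trans (ler_normB _ _) _; lra.
move=> u [] uz.
- by apply: (image_hole z) => // v vz; apply: sub; left.
- apply: (image_hole (2 * x - z)); first by move=> v vz; apply: sub; right.
  by rewrite (_ : h x + _ = 2 * h x - (h x + w * (z - x))) //; lra.
Qed.
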